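(* Let $q$ be a prime power and let $P=\langle\lambda,\mu\rangle$ be a plane partition of format $2\times3\times2$ with $P\subseteq\Delta$, i.e. $\lambda_1\le2$, $\lambda_2\le1$, $\mu_1\le1$, $\mu_2=0$. The number of nondegenerate $2\times3\times2$ hypermatrices over $\mathbb F_q$ which respect $P$ is $$q^{4}(q-1)^{4}\,[3-\lambda_1]_q[2-\lambda_2]_q\cdot[2-\mu_1]_q[1-\mu_2]_q.$$
   Context: Notation: $[n]_q=1+q+\dots+q^{n-1}$ for $n\ge1$. A $2\times3\times2$ hypermatrix over a field $\mathbb{F}$ is an array $M=(M_{h,i,j})$ with entries in $\mathbb F$, $1\le h\le 2$, $1\le i\le 3$, $1\le j\le 2$; it is viewed as the pair $(M_1,M_2)$ of $3\times2$ matrices $(M_h)_{i,j}=M_{h,i,j}$. It is nondegenerate if its (Cayley / Gelfand–Kapranov–Zelevinsky) hyperdeterminant is nonzero; for this format this is known to be equivalent to the condition, which may be taken as the definition, that $c_1M_1+c_2M_2$ has rank $2$ for all $(c_1,c_2)\neq(0,0)$ in $\overline{\mathbb F}^2$, where $\overline{\mathbb F}$ is the algebraic closure. A plane partition $P=\langle\lambda,\mu\rangle$ of format $2\times3\times2$ is a pair of sequences of integers $3\ge\lambda_1\ge\lambda_2\ge0$, $3\ge\mu_1\ge\mu_2\ge0$ with $\mu_j\le\lambda_j$ for $j=1,2$. A hypermatrix $M$ respects $P$ if $M_{1,i,j}=0$ whenever $i>3-\lambda_j$ and $M_{2,i,j}=0$ whenever $i>3-\mu_j$. *)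

(* Defs.v *)
From HB Require Import structures.
From mathcomp Require Import all_boot all_order all_algebra.
From mathcomp Require Import boolp.

Set Implicit Arguments.
Unset Strict Implicit.
Unset Printing Implicit Defensive.

Import GRing.Theory.

Definition qint (q n : nat) : nat := \sum_(i < n) q ^ i.

(* Indices are shifted down by one: M h i j is M_{h+1,i+1,j+1}. *)
Definition hypermatrix (F : finFieldType) : finType :=
  {ffun 'I_2 -> 'M[F]_(3, 2)}.

(* A plane partition <lam, mu> of format 2 x 3 x 2; [lam ord0] is lambda_1
   and [lam ord_max] is lambda_2, likewise for [mu]. *)
Record plane_partition := PlanePartition {
  lam : 'I_2 -> nat;
  mu : 'I_2 -> nat;
  lam_le3 : lam ord0 <= 3;
  lam_noninc : lam ord_max <= lam ord0;
  mu_le3 : mu ord0 <= 3;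
  mu_noninc : mu ord_max <= mu ord0;
  mu_le_lam : forall j, mu j <= lam j
}.

(* The 1-based row number of i : 'I_3 is i.+1. *)
Definition hm_respects (F : finFieldType) (P : plane_partition)
    (M : hypermatrix F) : Prop :=
  (forall (i : 'I_3) (j : 'I_2), 3 - lam P j < i.+1 -> M ord0 i j = 0%R) /\
  (forall (i : 'I_3) (j : 'I_2), 3 - mu P j < i.+1 -> M ord_max i j = 0%R).

(* [iota : F -> K] is meant to be an algebraic closure of F. For this format the
   condition is equivalent to nonvanishing of the hyperdeterminant. *)
Definition hm_nondegenerate (F : finFieldType) (K : closedFieldType)
    (iota : {rmorphism F -> K}) (M : hypermatrix F) : Prop :=
  forall c1 c2 : K, (c1, c2) <> (0%R, 0%R) ->
    \rank (c1 *: map_mx iota (M ord0) + c2 *: map_mx iota (M ord_max))%R = 2.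

(* Main.v *)
Require Import Defs.
From HB Require Import structures.
From mathcomp Require Import all_boot all_order all_algebra.
From mathcomp Require Import boolp.
From mathcomp Require Import ring.

Set Implicit Arguments.
Unset Strict Implicit.
Unset Printing Implicit Defensive.

Import GRing.Theory.

(** Write x, y for the columns of M_1 and z, w for those of M_2.  If M is
    nondegenerate, then x <> 0 and neither y nor z lies on the line <x>.
    Conversely, given such x, y, z in F_q^3, exactly q^2 of the q^3 vectors w
    give a degenerate M: if z is in the plane <x, y> these are the vectors of
    that plane, and if (x, y, z) is a basis they are the vectors
    -st x + s y + t z.  As mu_2 = 0, the partition puts no constraint on w, and
    since the supports allowed for y and z contain the one for x, the count is
    (q^a - 1)(q^b - q)(q^c - q)(q^3 - q^2), where a = 3 - lambda_1,
    b = 3 - lambda_2 and c = 3 - mu_1. *)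

Local Open Scope ring_scope.

(** * Linear independence and nonsingularity criteria for quadruples of vectors *)

Lemma row_free_rcons (F : fieldType) m n (A : 'M[F]_(m, n)) (z : 'rV_n) :
  row_free A -> ~~ (z <= A)%MS -> row_free (col_mx A z).
Proof.
move=> freeA zA; apply: inj_row_free => v; rewrite -[v]hsubmxK mul_row_col.
rewrite [rsubmx v]mx11_scalar mul_scalar_mx => /eqP.
have [-> | a0] := eqVneq (rsubmx v 0 0) 0.
  rewrite scale0r addr0 mulmx_free_eq0 // => /eqP ->.
  by rewrite raddf0 row_mx0.
rewrite addrC addr_eq0 => /eqP az; case/negP: zA.
by rewrite -(eqmx_scale _ a0) az eqmx_opp submxMl.
Qed.

Lemma row_free2P (F : fieldType) n (x y : 'rV[F]_n) :
  row_free (col_mx x y) <->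
  (forall a b : F, a *: x + b *: y = 0 -> a = 0 /\ b = 0).
Proof.
split=> [fxy a b|xy0].
  rewrite -!mul_scalar_mx -mul_row_col => /eqP; rewrite mulmx_free_eq0 // => /eqP.
  rewrite -row_mx0 => /eq_row_mx[/matrixP/(_ 0 0) + /matrixP/(_ 0 0)].
  by rewrite !mxE.
apply: inj_row_free => v; rewrite -[v]hsubmxK mul_row_col.
rewrite [lsubmx v]mx11_scalar [rsubmx v]mx11_scalar !mul_scalar_mx => /xy0[-> ->].
by rewrite !raddf0 row_mx0.
Qed.

Lemma row_free3P (F : fieldType) n (x y z : 'rV[F]_n) (a b c : F) :
  row_free (col_mx (col_mx x y) z) -> a *: x + b *: y + c *: z = 0 ->
  [/\ a = 0, b = 0 & c = 0].
Proof.
move=> fxyz; rewrite -!mul_scalar_mx -!mul_row_col => /eqP.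
rewrite mulmx_free_eq0 // => /eqP; rewrite -row_mx0 => /eq_row_mx[].
rewrite -row_mx0.
move=> /eq_row_mx[/matrixP/(_ 0 0) + /matrixP/(_ 0 0) + /matrixP/(_ 0 0)].
by rewrite !mxE.
Qed.

(* For n = 3 the slices (x | y) and (z | w) form a nondegenerate hypermatrix;
   the vanishing sum says that c1 (x | y) + c2 (z | w) kills (v1, v2)^T. *)
Definition nonsingular4 (K : fieldType) n (x y z w : 'rV[K]_n) : Prop :=
  forall c1 c2 v1 v2 : K,
    (c1 * v1) *: x + (c1 * v2) *: y + (c2 * v1) *: z + (c2 * v2) *: w = 0 ->
    (c1 = 0 /\ c2 = 0) \/ (v1 = 0 /\ v2 = 0).

(** Each forbidden configuration produces an explicit singular direction: M_1 alone kills (1, 0) if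
    x = 0 and (a, -1) if y = a x, while a M_1 - M_2 kills (1, 0) if z = a x. *)
Lemma nonsingular4_nsub (K : fieldType) n (x y z w : 'rV[K]_n) :
  nonsingular4 x y z w -> [/\ x != 0, ~~ (y <= x)%MS & ~~ (z <= x)%MS].
Proof.
move=> ns; have no1 : ~ (1 = 0 :> K) by apply/eqP; exact: oner_neq0.
split.
- apply/eqP=> x0; case: (ns 1 0 1 0) => [|[//]|[//]].
  by rewrite x0; apply/rowP=> i; rewrite !mxE; ring.
- apply/sub_rVP=> -[a y0]; case: (ns 1 0 a (-1)) => [|[//]|[_ /eqP]].
    by rewrite y0; apply/rowP=> i; rewrite !mxE; ring.
  by rewrite oppr_eq0 oner_eq0.
apply/sub_rVP=> -[a z0]; case: (ns a (-1) 1 0) => [|[_ /eqP]|[//]].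
  by rewrite z0; apply/rowP=> i; rewrite !mxE; ring.
by rewrite oppr_eq0 oner_eq0.
Qed.

(** The products c_i v_j satisfy the rank-one identity (c1 v1)(c2 v2) = (c1 v2)(c2 v1). Independence
    of x, y, z expresses the other three products through c2 v2, and the identity becomes (c2 v2)^2
    (a + b c) = 0. *)
Lemma nonsingular4_basis (K : fieldType) n (x y z : 'rV[K]_n) (a b c : K) :
  row_free (col_mx (col_mx x y) z) ->
  nonsingular4 x y z (a *: x + b *: y + c *: z) <-> a != - (b * c).
Proof.
move=> fxyz; split=> [ns|abc c1 c2 v1 v2 E].
  (* After normalising c2 = v2 = 1, the coefficients of y and z force c1 = -b and v1 = -c. *)
  apply/eqP=> a0; case: (ns (- b) 1 (- c) 1) => [|[_ /eqP]|[_ /eqP]].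
  - by rewrite a0; apply/rowP=> i; rewrite !mxE; ring.
  - by rewrite oner_eq0.
  - by rewrite oner_eq0.
case: (@row_free3P _ _ x y z (c1 * v1 + c2 * v2 * a)
  (c1 * v2 + c2 * v2 * b) (c2 * v1 + c2 * v2 * c)) => // [|E1 E2 E3].
  by rewrite -{}E; apply/rowP=> i; rewrite !mxE; ring.
have /eqP : (c2 * v2) ^+ 2 * (a + b * c) = 0.
  have -> : (c2 * v2) ^+ 2 * (a + b * c) =
    (c2 * v2) * (c1 * v1 + c2 * v2 * a) - (c1 * v2) * (c2 * v1 + c2 * v2 * c)
    + (c2 * v2 * c) * (c1 * v2 + c2 * v2 * b) by ring.
  by rewrite E1 E2 E3; ring.
rewrite mulf_eq0 addr_eq0 (negPf abc) orbF expf_eq0 /= => /eqP E4.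
(* Now all four products c_i v_j vanish, so one of the two vectors is zero. *)
move: E1 E2 E3; rewrite E4 !mul0r !addr0 => /eqP + /eqP + /eqP.
move/eqP: E4; rewrite !mulf_eq0.
case: (eqVneq c2 0) => [->|_] /=; case: (eqVneq c1 0) => [->|_] //=; first by left.
- by move=> _ /eqP -> /eqP ->; right.
- by move=> /eqP -> _ _ /eqP ->; right.
by move=> /eqP -> /eqP ->; right.
Qed.

Lemma closed_field_quadratic_root (K : closedFieldType) (b c : K) :
  exists r, r ^+ 2 + b * r + c = 0.
Proof.
have [r Er] := @solve_monicpoly K 2 (fun i => if i is 0%N then - c else - b) isT.
exists r; rewrite Er !big_ord_recl big_ord0 /= ; rewrite /bump /=; ring.
Qed.

(* For w in the plane, a singular direction (c1, 1) is an eigenvalue problem for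
   a 2 x 2 matrix, hence the algebraically closed field. *)
Lemma nonsingular4_plane (K : closedFieldType) n (x y w : 'rV[K]_n) (s t : K) :
  row_free (col_mx x y) -> t != 0 ->
  nonsingular4 x y (s *: x + t *: y) w <-> ~~ (w <= col_mx x y)%MS.
Proof.
move=> fxy t0; split=> [ns|wxy c1 c2 v1 v2 E].
  rewrite -addsmxE; apply/sub_addsmxP=> -[[u v] /= Ew].
  move: Ew; rewrite [u]mx11_scalar [v]mx11_scalar !mul_scalar_mx.
  move: (u 0 0) (v 0 0) => a b Ew.
  (* With w = a x + b y, the direction (c, 1) is singular when -c is an eigenvalue of the matrix
     with rows (s, a) and (t, b). This is its characteristic equation, and (c + b, -t) is an
     eigenvector, nonzero because t is. *)
  have [c Ec] := closed_field_quadratic_root (s + b) (s * b - a * t).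
  case: (ns c 1 (c + b) (- t)) => [|[_ /eqP]|[_ /eqP]].
  - rewrite Ew; apply/rowP=> i; rewrite !mxE -[RHS](mul0r (x 0 i)) -Ec; ring.
  - by rewrite oner_eq0.
  - by rewrite oppr_eq0 (negPf t0).
have fw := row_free_rcons fxy wxy.
case: (@row_free3P _ _ x y w (c1 * v1 + c2 * v1 * s) (c1 * v2 + c2 * v1 * t)
  (c2 * v2)) => // [|/eqP + /eqP + /eqP].
  by rewrite -{}E; apply/rowP=> i; rewrite !mxE; ring.
rewrite [c2 * v2 == 0]mulf_eq0 => + + /orP[]/eqP E0; rewrite E0.
  rewrite !mul0r !addr0 !mulf_eq0; case: (eqVneq c1 0) => [->|_] /=; first by left.
  by move=> /eqP -> /eqP ->; right.
(* Case v2 = 0: the coefficient of y is c2 v1 t, so t != 0 gives c2 v1 = 0. *)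
rewrite mulr0 add0r !mulf_eq0 (negPf t0) orbF => + /orP[]/eqP E1.
  by rewrite E1 !mul0r addr0 mulf_eq0 => /orP[]/eqP ->; [left|right].
by move=> _; right.
Qed.

(** * Counting the fourth vector when the first three are given *)

Section CountLast.

Variables (F : finFieldType) (K : closedFieldType) (iota : {rmorphism F -> K}).

(** Nondegeneracy is tested over K, but by the two criteria it depends only on linear independence
    and on equalities in F, which the injective [iota] preserves and reflects. The degenerate w are
    then the image of an injection from [F * F]. *)
Lemma card_nonsingular4_last (x y z : 'rV[F]_3) :
  x != 0 -> ~~ (y <= x)%MS -> ~~ (z <= x)%MS ->
  #|[set w : 'rV[F]_3 | `[< nonsingular4 (map_mx iota x) (map_mx iota y)
       (map_mx iota z) (map_mx iota w) >]]| = (#|F| ^ 3 - #|F| ^ 2)%N.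
Proof.
move=> x0 yx zx.
suff [phi [inj_phi phiP]] : exists phi : F * F -> 'rV[F]_3, injective phi /\
    forall w, nonsingular4 (map_mx iota x) (map_mx iota y)
       (map_mx iota z) (map_mx iota w) <-> w \notin codom phi.
  transitivity #|~: (phi @: [set: F * F])|.
    apply: eq_card => w; rewrite inE in_setC; apply/asboolP/idP.
      by move/phiP; apply: contra => /imsetP[p _ ->]; apply: codom_f.
    by move=> wphi; apply/phiP; apply: contra wphi => /codomP[p ->]; apply: imset_f.
  by rewrite cardsCs setCK card_imset // cardsT card_prod card_mx mul1n mulnn.
have fx : row_free x by rewrite /row_free rank_rV x0.
have fxy := row_free_rcons fx yx.
case: (boolP (z <= col_mx x y)%MS) => [|zxy].
  rewrite -addsmxE => /sub_addsmxP[[u v] /=].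
  rewrite [u]mx11_scalar [v]mx11_scalar !mul_scalar_mx.
  move: (u 0 0) (v 0 0) => s t Ez.
  have t0 : t != 0.
    apply: contraNneq zx => t0; apply/sub_rVP; exists s.
    by rewrite Ez t0 scale0r addr0.
  exists (fun p => p.1 *: x + p.2 *: y); split=> [[a b] [a' b'] /= E|w].
    case: ((row_free2P x y).1 fxy (a - a') (b - b')).
      by rewrite !scalerBl addrACA E -opprD subrr.
    by move=> /subr0_eq -> /subr0_eq ->.
  rewrite Ez map_mxD !map_mxZ (nonsingular4_plane (n := 3)); last 2 first.
  - by rewrite -map_col_mx row_free_map.
  - by rewrite fmorph_eq0.
  rewrite -map_col_mx map_submx; split; apply: contra.
    by case/codomP=> p ->; rewrite -addsmxE addmx_sub_adds ?scalemx_sub.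
  rewrite -addsmxE => /sub_addsmxP[[u' v'] /=].
  rewrite [u']mx11_scalar [v']mx11_scalar !mul_scalar_mx => ->.
  by apply/codomP; exists (u' 0 0, v' 0 0).
have fxyz := row_free_rcons fxy zxy.
(* These w violate [a != - (b * c)]; they form a graph over the y- and z-coordinates, which gives
   injectivity. *)
exists (fun p => - (p.1 * p.2) *: x + p.1 *: y + p.2 *: z); split.
  move=> [b c] [b' c'] /= E.
  case: (@row_free3P _ _ x y z (b' * c' - b * c) (b - b') (c - c') fxyz).
    move/eqP: E; rewrite -subr_eq0 => /eqP <-.
    by apply/rowP=> i; rewrite !mxE; ring.
  by move=> _ /subr0_eq -> /subr0_eq ->.
move=> w.
have : (w <= col_mx (col_mx x y) z)%MS by apply: submx_full; exact: fxyz.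
case/submxP=> u; rewrite -[u]hsubmxK -[lsubmx u]hsubmxK !mul_row_col.
rewrite [rsubmx u]mx11_scalar [lsubmx (lsubmx u)]mx11_scalar.
rewrite [rsubmx (lsubmx u)]mx11_scalar !mul_scalar_mx.
move: (lsubmx (lsubmx u) 0 0) (rsubmx (lsubmx u) 0 0) (rsubmx u 0 0) => a b c Ew.
rewrite Ew !map_mxD !map_mxZ (nonsingular4_basis (n := 3)); last first.
  by rewrite -!map_col_mx row_free_map.
rewrite -rmorphM -rmorphN (inj_eq (fmorph_inj iota)); split; apply: contra.
  case/codomP=> -[b' c'] /= E.
  case: (@row_free3P _ _ x y z (a + b' * c') (b - b') (c - c') fxyz).
    move/eqP: E; rewrite -subr_eq0 => /eqP <-.
    by apply/rowP=> i; rewrite !mxE; ring.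
  by move=> /eqP + /subr0_eq -> /subr0_eq ->; rewrite addr_eq0.
by move/eqP->; apply/codomP; exists (b, c).
Qed.

End CountLast.

(** * Counting by fibres, and coordinate subspaces *)

Lemma card_fibers (A B : finType) (D : {set A}) (S : {set A * B}) (n : nat) :
  (forall p, p \in S -> p.1 \in D) ->
  (forall a, a \in D -> #|[set b | (a, b) \in S]| = n) ->
  #|S| = (#|D| * n)%N.
Proof.
move=> SD Sn; rewrite -sum1_card (partition_big fst (mem D)) //=.
rewrite -sum_nat_const; apply: eq_bigr => a /Sn <-.
rewrite sum1dep_card -[RHS](card_imset _ (f := pair a)); last by move=> b b' [].
apply: eq_card => -[a' b]; rewrite inE /=; apply/andP/imsetP => [[aS /eqP /= <-]|].
  by exists b; rewrite ?inE.
by case=> b'; rewrite inE => aS [-> ->].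
Qed.

Section Flag.

Variables (F : finFieldType) (m : nat).

(** These nested subspaces are the supports that a partition allows for a column: a part k
    corresponds to a = 3 - k. *)
Definition coord_flag (a : nat) : {set 'rV[F]_m} :=
  [set x : 'rV[F]_m | [forall i : 'I_m, (a <= i)%N ==> (x 0 i == 0)]].

Lemma coord_flagP a (x : 'rV[F]_m) :
  reflect (forall i : 'I_m, (a <= i)%N -> x 0 i = 0) (x \in coord_flag a).
Proof.
rewrite inE; apply: (iffP forallP) => x0 i; last by apply/implyP=> /x0 ->.
by move=> ai; apply/eqP; exact: (implyP (x0 i)).
Qed.

Lemma coord_flag_full : coord_flag m = setT.
Proof.
by apply/setP=> x; rewrite [RHS]inE; apply/coord_flagP => i; rewrite leqNgt ltn_ord.
Qed.

Lemma coord_flagS a b : (a <= b)%N -> coord_flag a \subset coord_flag b.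
Proof.
move=> ab; apply/subsetP=> x /coord_flagP x0; apply/coord_flagP=> i bi.
by apply: x0; apply: leq_trans bi.
Qed.

Lemma coord_flagZ a (t : F) x : x \in coord_flag a -> t *: x \in coord_flag a.
Proof. by move=> /coord_flagP x0; apply/coord_flagP=> i ai; rewrite mxE x0 ?mulr0. Qed.

Lemma coord_flag0 a : 0 \in coord_flag a.
Proof. by apply/coord_flagP=> i _; rewrite mxE. Qed.

(** The subspace contains x, hence its whole line, which has [#|F|] points because x is nonzero. *)
Lemma card_coord_flagD_line a x : x != 0 -> x \in coord_flag a ->
  #|[set y : 'rV[F]_m in coord_flag a | ~~ (y <= x)%MS]| = (#|coord_flag a| - #|F|)%N.
Proof.
move=> x0 xa.
have inj_x : injective (fun t : F => t *: x).
  move=> s t /eqP; rewrite -subr_eq0 -scalerBl scaler_eq0 (negPf x0) orbF.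
  by rewrite subr_eq0 => /eqP.
have -> : [set y : 'rV[F]_m in coord_flag a | ~~ (y <= x)%MS]
    = coord_flag a :\: [set t *: x | t : F].
  apply/setP=> y; rewrite in_setD [LHS]in_set andbC; congr (~~ _ && _).
  by apply/sub_rVP/imsetP=> [[t ->]|[t _ ->]]; exists t.
rewrite cardsDS ?card_imset //.
by apply/subsetP=> _ /imsetP[t _ ->]; apply: coord_flagZ.
Qed.

End Flag.

Lemma card_coord_flag (F : finFieldType) m a :
  (a <= m)%N -> #|coord_flag F m a| = (#|F| ^ a)%N.
Proof.
move=> /subnKC <-; move: (m - a)%N => k.
rewrite -[X in (_ ^ X)%N]mul1n -card_mx -cardsT.
rewrite -(card_imset [set: 'rV[F]_a] (f := fun u => row_mx u (0 : 'rV[F]_k)));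
  last by move=> u v /eq_row_mx[].
apply: eq_card => x; apply/coord_flagP/imsetP => [x0|[u _ ->] i ai].
  exists (lsubmx x) => //; rewrite -[LHS]hsubmxK; congr row_mx.
  by apply/rowP=> i; rewrite !mxE x0 //= leq_addr.
rewrite mxE; case: splitP => j ij; last by rewrite mxE.
by move: ai; rewrite ij leqNgt ltn_ord.
Qed.

(** * Counting nonsingular quadruples with prescribed supports *)

Section CountQuadruples.

Variables (F : finFieldType) (K : closedFieldType) (iota : {rmorphism F -> K}).

Notation V := 'rV[F]_3.

Definition nonsingular_quadruples (a b c : nat) : {set V * V * V * V} :=
  [set p : V * V * V * V | [&& p.1.1.1 \in coord_flag F 3 a, p.1.1.2 \in coord_flag F 3 b,
     p.1.2 \in coord_flag F 3 c & `[< nonsingular4 (map_mx iota p.1.1.1)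
       (map_mx iota p.1.1.2) (map_mx iota p.1.2) (map_mx iota p.2) >]]].

(** The vectors are chosen in the order x, y, z, w. Both y and z only have to avoid the line of x,
    so the choice of y does not affect the count for z; a <= b and a <= c place that line inside the
    supports of y and z. *)
Lemma card_nonsingular_quadruples a b c :
  (a <= b <= 3)%N -> (a <= c <= 3)%N ->
  #|nonsingular_quadruples a b c| =
  ((#|F| ^ a - 1) * (#|F| ^ b - #|F|) * (#|F| ^ c - #|F|) *
   (#|F| ^ 3 - #|F| ^ 2))%N.
Proof.
move=> /andP[ab b3] /andP[ac c3]; have a3 := leq_trans ab b3.
pose X := coord_flag F 3 a :\ 0.
pose XY : {set V * V} :=
  [set p : V * V | p.1 \in X & p.2 \in [set y : V in coord_flag F 3 b | ~~ (y <= p.1)%MS]].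
pose XYZ : {set V * V * V} :=
  [set p : V * V * V | p.1 \in XY & p.2 \in [set z : V in coord_flag F 3 c | ~~ (z <= p.1.1)%MS]].
have cX : #|X| = (#|F| ^ a - 1)%N.
  by rewrite -(card_coord_flag F a3) (cardsD1 0 (coord_flag F 3 a)) coord_flag0 addKn.
have cXY : #|XY| = (#|X| * (#|F| ^ b - #|F|))%N.
  apply: card_fibers => [p|x xX]; first by rewrite inE => /andP[].
  move: (xX); rewrite !inE => /andP[x0 xa].
  rewrite -(card_coord_flag F b3) -(card_coord_flagD_line (x := x)) //; last first.
    by apply: (subsetP (coord_flagS _ _ ab)); rewrite inE.
  by apply: eq_card => y; rewrite !in_set /= in_set1 x0 xa.
have cXYZ : #|XYZ| = (#|XY| * (#|F| ^ c - #|F|))%N.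
  apply: card_fibers => [p|[x y] xyXY]; first by rewrite inE => /andP[].
  move: (xyXY); rewrite inE /= => /andP[]; rewrite in_setD1 => /andP[x0 xa] _.
  rewrite -(card_coord_flag F c3) -(card_coord_flagD_line (x := x)) //; last first.
    by apply: (subsetP (coord_flagS _ _ ac)).
  by apply: eq_card => z; rewrite in_set [LHS]in_set xyXY.
(* The necessary conditions on x, y, z make the projection land in [XYZ]; each fibre over it is a
   set of admissible w. *)
rewrite -cX -cXY -cXYZ; apply: card_fibers => [[[[x y] z] w]|[[x y] z]].
  rewrite in_set /= => /and4P[xa yb zc /asboolP/nonsingular4_nsub[]].
  rewrite !map_submx map_mx_eq0 => x0 yx zx.
  rewrite in_set /=; apply/andP; split; last by rewrite in_set zc zx.
  rewrite in_set /=; apply/andP; split; last by rewrite in_set yb yx.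
  by rewrite in_setD1 xa x0.
rewrite in_set /= => /andP[]; rewrite in_set /= => /andP[].
rewrite in_setD1 => /andP[x0 xa]; rewrite in_set => /andP[yb yx].
rewrite in_set => /andP[zc zx].
rewrite -(card_nonsingular4_last iota x0 yx zx); apply: eq_card => w.
by rewrite in_set [LHS]in_set [RHS]in_set /= xa yb zc.
Qed.

End CountQuadruples.

(** * From quadruples of vectors to hypermatrices *)

Lemma col_mx11_ord0 (R : Type) n (x y : 'rV[R]_n) (i : 'I_n) :
  col_mx x y (ord0 : 'I_2) i = x 0 i.
Proof. by rewrite -[RHS](col_mxEu x y); congr (col_mx x y _ i); apply: val_inj. Qed.

Lemma col_mx11_ord_max (R : Type) n (x y : 'rV[R]_n) (i : 'I_n) :
  col_mx x y (ord_max : 'I_2) i = y 0 i.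
Proof. by rewrite -[RHS](col_mxEd x y); congr (col_mx x y _ i); apply: val_inj. Qed.

Section HypermatrixOfRows.

Variable F : finFieldType.

Notation V := 'rV[F]_3.

(** The columns of the slices are stored as row vectors, so that the row-space theory of matrices
    applies to them directly. *)
Definition hm_of_rows (p : V * V * V * V) : hypermatrix F :=
  [ffun h : 'I_2 => if h == ord0 then (col_mx p.1.1.1 p.1.1.2)^T
                    else (col_mx p.1.2 p.2)^T].

Lemma hm_of_rows_ord0 p : hm_of_rows p ord0 = (col_mx p.1.1.1 p.1.1.2)^T.
Proof. by rewrite ffunE eqxx. Qed.

Lemma hm_of_rows_ord_max p : hm_of_rows p ord_max = (col_mx p.1.2 p.2)^T.
Proof. by rewrite ffunE. Qed.

Lemma hm_of_rows_bij : bijective hm_of_rows.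
Proof.
pose up (A : 'M[F]_(3, 2)) : V := @usubmx F 1 1 3 A^T.
pose dn (A : 'M[F]_(3, 2)) : V := @dsubmx F 1 1 3 A^T.
exists (fun M : hypermatrix F => (up (M ord0), dn (M ord0), up (M ord_max), dn (M ord_max))).
  move=> [[[x y] z] w]; rewrite hm_of_rows_ord0 hm_of_rows_ord_max /up /dn /=.
  by rewrite !trmxK !col_mxKu !col_mxKd.
move=> M; apply/ffunP=> h; have [->|h1] : h = ord0 \/ h = ord_max.
- by case: h => -[|[|//]] hh; [left|right]; apply: val_inj.
- by rewrite hm_of_rows_ord0 /= vsubmxK trmxK.
by rewrite h1 hm_of_rows_ord_max /= vsubmxK trmxK.
Qed.

(** A 3 x 2 matrix has rank 2 exactly when its columns are independent, and a dependence (v1, v2)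
    between the columns of c1 M_1 + c2 M_2 expands into the four-term sum of [nonsingular4]. *)
Lemma hm_of_rows_nondegenerate (K : closedFieldType)
    (iota : {rmorphism F -> K}) (x y z w : V) :
  hm_nondegenerate iota (hm_of_rows (x, y, z, w)) <->
  nonsingular4 (map_mx iota x) (map_mx iota y) (map_mx iota z) (map_mx iota w).
Proof.
rewrite /hm_nondegenerate hm_of_rows_ord0 hm_of_rows_ord_max /=.
have rankE c1 c2 : \rank (c1 *: map_mx iota (col_mx x y)^T
      + c2 *: map_mx iota (col_mx z w)^T)%R = 2%N <->
    row_free (col_mx (c1 *: map_mx iota x + c2 *: map_mx iota z)
                     (c1 *: map_mx iota y + c2 *: map_mx iota w)).
  rewrite -mxrank_tr linearD !linearZ /= -!map_trmx !trmxK.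
  by rewrite !map_col_mx !scale_col_mx add_col_mx; split=> /eqP.
have sumE c1 c2 v1 v2 : v1 *: (c1 *: map_mx iota x + c2 *: map_mx iota z)
      + v2 *: (c1 *: map_mx iota y + c2 *: map_mx iota w)
    = (c1 * v1) *: map_mx iota x + (c1 * v2) *: map_mx iota y
      + (c2 * v1) *: map_mx iota z + (c2 * v2) *: map_mx iota w.
  by apply/rowP=> i; rewrite !mxE; ring.
split=> [nd c1 c2 v1 v2 E|ns c1 c2 c0].
  have [[-> ->]|c0] := pselect ((c1, c2) = (0, 0)); first by left.
  by right; apply: (row_free2P _ _).1 ((rankE _ _).1 (nd _ _ c0)) _ _ _; rewrite sumE.
apply/rankE/row_free2P => v1 v2; rewrite sumE => /ns[] // [c10 c20].
by case: c0; rewrite c10 c20.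
Qed.

Lemma hm_of_rows_respects (P : plane_partition) (x y z w : V) :
  hm_respects P (hm_of_rows (x, y, z, w)) <->
  [/\ x \in coord_flag F 3 (3 - lam P ord0),
      y \in coord_flag F 3 (3 - lam P ord_max),
      z \in coord_flag F 3 (3 - mu P ord0) &
      w \in coord_flag F 3 (3 - mu P ord_max)].
Proof.
(* One slice at a time; the 1-based bound [3 - nu j < i.+1] is the 0-based [3 - nu j <= i] of
   [coord_flag]. *)
have colsE (A : 'M[F]_(3, 2)) (u v : V) (nu : 'I_2 -> nat) :
    A = (col_mx u v)^T ->
    (forall (i : 'I_3) (j : 'I_2), (3 - nu j < i.+1)%N -> A i j = 0) <->
    u \in coord_flag F 3 (3 - nu ord0) /\ v \in coord_flag F 3 (3 - nu ord_max).
  move=> ->; split=> [A0|[/coord_flagP u0 /coord_flagP v0] i j].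
    split; apply/coord_flagP => i /(A0 i); rewrite mxE.
      by rewrite col_mx11_ord0.
    by rewrite col_mx11_ord_max.
  have [->|->] : j = ord0 \/ j = ord_max.
  - by case: j => -[|[|//]] hj; [left|right]; apply: val_inj.
  - by rewrite mxE col_mx11_ord0; apply: u0.
  by rewrite mxE col_mx11_ord_max; apply: v0.
rewrite /hm_respects (colsE _ _ _ _ (hm_of_rows_ord0 _)).
rewrite (colsE _ _ _ _ (hm_of_rows_ord_max _)) /=.
by split=> [[[]] ? ? []|[]].
Qed.

End HypermatrixOfRows.

Local Close Scope ring_scope.

(** * Passage to q-integers and the final count *)

Lemma qint_expn q n : q ^ n - 1 = (q - 1) * qint q n.
Proof. by rewrite !subn1 predn_exp. Qed.

Lemma qint_expnS q n : q ^ n.+1 - q = q * ((q - 1) * qint q n).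
Proof. by rewrite -qint_expn mulnBr muln1 expnS. Qed.

Theorem mainTheorem5 (q : nat)
  (hq : exists p k : nat, [/\ prime p, 0 < k & q = p ^ k])
  (F : finFieldType) (hF : #|F| = q)
  (K : closedFieldType) (iota : {rmorphism F -> K})
  (hK : integralRange iota)
  (P : plane_partition)
  (hlam1 : lam P ord0 <= 2) (hlam2 : lam P ord_max <= 1)
  (hmu1 : mu P ord0 <= 1) (hmu2 : mu P ord_max = 0) :
  #|[set M : hypermatrix F | `[< hm_nondegenerate iota M /\ hm_respects P M >]]| =
  q ^ 4 * (q - 1) ^ 4 *
  (qint q (3 - lam P ord0) * qint q (2 - lam P ord_max)) *
  (qint q (2 - mu P ord0) * qint q (1 - mu P ord_max)).
Proof.
rewrite -(on_card_preimset (onW_bij _ (hm_of_rows_bij F))).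
have -> : hm_of_rows (F:=F) @^-1: [set M : hypermatrix F |
      `[< hm_nondegenerate iota M /\ hm_respects P M >]]
    = nonsingular_quadruples iota (3 - lam P ord0) (3 - lam P ord_max)
        (3 - mu P ord0).
  apply/setP=> -[[[x y] z] w]; rewrite [RHS]in_set 2!in_set /=; apply/asboolP/and4P.
    by case=> /hm_of_rows_nondegenerate/asboolP ns /hm_of_rows_respects[xa yb zc _]; split.
  case=> xa yb zc /asboolP/hm_of_rows_nondegenerate nd; split=> //.
  (* Since mu_2 = 0, the support allowed for w is the whole space. *)
  by apply/hm_of_rows_respects; split=> //; rewrite hmu2 coord_flag_full in_setT.
have lam10 := lam_noninc P; have mulam := mu_le_lam P ord0.
(* The inclusions of supports come from lambda_2 <= lambda_1 and mu_1 <= lambda_1. *)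
rewrite card_nonsingular_quadruples ?leq_sub2l ?leq_subr // hF.
(* The bounds lambda_2 <= 1 and mu_1 <= 1 turn the exponents 3 - lambda_2 and 3 - mu_1 into
   successors, so a factor q splits off from each of the two middle terms. *)
rewrite hmu2 (subSn (leqW hlam2)) (subSn (leqW hmu1)) qint_expn !qint_expnS.
have -> : q ^ 3 - q ^ 2 = q ^ 2 * (q - 1) by rewrite mulnBr muln1 -expnSr.
by rewrite [qint q (1 - 0)]big_ord1; ring.
Qed.
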